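(* Let $n\ge2$, $q\in\Bbbk$ a primitive $n$-th root of unity, $H=T_q\otimes T_{q^{-1}}$, $G=\mathbb{Z}_n\times\mathbb{Z}_n$, and let $\chi_1,\chi_2:G\to\Bbbk^\times$ be characters with $\chi_1(1,g^{-1})\chi_2(g,1)=1$. Any homogeneous left coideal subalgebra $K=\bigoplus_{i=0}^mK(i)$ of $H$ (respectively, of $H_{(\chi_1,\chi_2)}$) is of the form $K=C(W^1,W^2,W^3,F)$ (respectively, $K=C_{(\chi_1,\chi_2)}(W^1,W^2,W^3,F)$) for some coideal subalgebra datum $(W^1,W^2,W^3,F)$ for $H$ (respectively, for $H_{(\chi_1,\chi_2)}$).
   Context: $\Bbbk$ is an algebraically closed field of characteristic zero. $G=\mathbb{Z}_n\times\mathbb{Z}_n=\langle g\rangle\times\langle g\rangle$, $g^n=1$; $V_1=\Bbbk x$, $V_2=\Bbbk y$, with $G$-action $(g^i,g^j)\cdot x=q^ix$, $(g^i,g^j)\cdot y=q^jy$. $H=T_q\otimes T_{q^{-1}}$ is the Hopf algebra generated by $G$, $x$, $y$ with relations $x^n=0=y^n$, $xy=yx$, $fx=(f\cdot x)f$, $fy=(f\cdot y)f$ for $f\in G$, and $\Delta(x)=x\otimes1+(g,1)\otimes x$, $\Delta(y)=y\otimes1+(1,g^{-1})\otimes y$, $\Delta(f)=f\otimes f$. $H_{(\chi_1,\chi_2)}$ is the Hopf algebra generated by $G,x,y$ with relations $x^n=0=y^n$, $xy=\chi_2(g,1)\,yx$, $fx=(f\rhd x)f$, $fy=(f\rhd y)f$,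 where $f\rhd x=\chi_1(f)\,f\cdot x$ and $f\rhd y=\chi_2(f)\,f\cdot y$, with the same coproduct on generators as $H$. Both are coradically graded with $\deg x=\deg y=1$ and degree-zero part $\Bbbk G$. A left coideal subalgebra $K$ (i.e. a subalgebra with $\Delta(K)\subseteq H\otimes K$) of a coradically graded Hopf algebra $H=\bigoplus_{i=0}^mH(i)$ is homogeneous if it is a graded algebra $K=\bigoplus_{i=0}^mK(i)$ with $K(i)\subseteq H(i)$. For $w=(v_1,v_2)\in V_1\oplus V_2$ put $[w]=v_1+v_2(g,g)$ and $\widetilde{[w]}=v_2+v_1(g^{-1},g^{-1})$. A coideal subalgebra datum is a collection $(W^1,W^2,W^3,F)$ such that: (1) $W=W^1\oplus W^2\oplus W^3$ is a subspace of $V_1\oplus V_2$ with $W\cap V_1=W^1$ and $W\cap V_2=W^2$; (2) $W^3\subseteq V_1\oplus V_2$ is a subspace with $W^3\cap(W^1\oplus W^2)=0$ and $W^3\cap V_1=0=W^3\cap V_2$; (3) $F\subseteq G$ is a subgroup leaving all the subspaces $W^i$, $i=1,2,3$, invariant (with respect to the action $\cdot$ for a datum for $H$, and the action $\rhd$ for a datum for $H_{(\chi_1,\chi_2)}$); (4) if $W^3\neq0$ then $(g,g)\in F$. Then $C(W^1,W^2,W^3,F)$ (respectively $C_{(\chi_1,\chi_2)}(W^1,W^2,W^3,F)$) is the subalgebra of $H$ (respectively of $H_{(\chi_1,\chi_2)}$) generated by $\Bbbk F$, the elements of $W^1\oplus W^2$, and $\{[w],\widetilde{[w]}: w\in W^3\}$.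 *)

(* Defs.v *)
From HB Require Import structures.
From mathcomp Require Import all_boot all_order all_algebra all_fingroup all_field.
From mathcomp Require Import sesquilinear.
Set Implicit Arguments.
Unset Strict Implicit.
Unset Printing Implicit Defensive.
Import GRing.Theory.
Local Open Scope ring_scope.

(* T is the tensor product algebra A (x) B, the simple tensor a (x) b being
   i a * j b.  The commutation condition is the product rule
   (a (x) b)(a' (x) b') = aa' (x) bb'. *)
Definition is_tensor_algebra (k : fieldType) (A B T : falgType k)
    (i : 'AHom(A, T)) (j : 'AHom(B, T)) : Prop :=
  (forall a b, i a * j b = j b * i a) /\
  (forall (V : lmodType k) (phi : {bilinear A -> B -> V}),
     exists f : {linear T -> V},
       (forall a b, f (i a * j b) = phi a b) /\
       (forall f' : {linear T -> V},
          (forall a b, f' (i a * j b) = phi a b) -> f' =1 f)).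

(* The tensor square and cube are determined up to isomorphism by their
   universal properties, so they are carried along as data.  The axioms are
   written on Sweedler decompositions: s lists the pairs (h_(1), h_(2)). *)
Record hopfAlgebra (k : fieldType) := HopfAlgebra {
  hopf_sort :> falgType k;
  hopf_sq : falgType k;
  hopf_inl : 'AHom(hopf_sort, hopf_sq);            (* a |-> a (x) 1 *)
  hopf_inr : 'AHom(hopf_sort, hopf_sq);            (* a |-> 1 (x) a *)
  hopf_sqP : is_tensor_algebra hopf_inl hopf_inr;
  hopf_cube : falgType k;
  hopf_in12 : 'AHom(hopf_sq, hopf_cube);           (* t |-> t (x) 1 *)
  hopf_in3 : 'AHom(hopf_sort, hopf_cube);          (* a |-> 1 (x) 1 (x) a *)
  hopf_cubeP : is_tensor_algebra hopf_in12 hopf_in3;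
  hopf_in23 : 'AHom(hopf_sq, hopf_cube);           (* t |-> 1 (x) t *)
  hopf_in23l : forall a, hopf_in23 (hopf_inl a) = hopf_in12 (hopf_inr a);
  hopf_in23r : forall a, hopf_in23 (hopf_inr a) = hopf_in3 a;
  comul : 'AHom(hopf_sort, hopf_sq);
  counit : {lrmorphism hopf_sort -> k^o};
  antipode : 'End(hopf_sort);
  comulA : forall h (s : seq (hopf_sort * hopf_sort)),
    comul h = \sum_(p <- s) hopf_inl p.1 * hopf_inr p.2 ->
    \sum_(p <- s) hopf_in12 (comul p.1) * hopf_in3 p.2
      = \sum_(p <- s) hopf_in12 (hopf_inl p.1) * hopf_in23 (comul p.2);
  counitP : forall h (s : seq (hopf_sort * hopf_sort)),
    comul h = \sum_(p <- s) hopf_inl p.1 * hopf_inr p.2 ->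
    \sum_(p <- s) counit p.1 *: p.2 = h
    /\ \sum_(p <- s) counit p.2 *: p.1 = h;
  antipodeP : forall h (s : seq (hopf_sort * hopf_sort)),
    comul h = \sum_(p <- s) hopf_inl p.1 * hopf_inr p.2 ->
    \sum_(p <- s) antipode p.1 * p.2 = (counit h)%:A
    /\ \sum_(p <- s) p.1 * antipode p.2 = (counit h)%:A
}.

Definition tens (k : fieldType) (H : hopfAlgebra k) (a b : H) : hopf_sq H :=
  hopf_inl H a * hopf_inr H b.

Definition left_coideal_subalgebra (k : fieldType) (H : hopfAlgebra k)
    (K : {vspace H}) : Prop :=
  [/\ 1 \in K,
      (K * K <= K)%VS &
      (comul H @: K <= limg (hopf_inl H) * (hopf_inr H @: K))%VS].

(* Hd is the grading of H, with top degree m. *)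
Definition homogeneous (k : fieldType) (H : hopfAlgebra k)
    (Hd : nat -> {vspace H}) (m : nat) (K : {vspace H}) : Prop :=
  exists Kd : nat -> {vspace H},
    [/\ forall i, (Kd i <= Hd i)%VS,
        forall i j, (Kd i * Kd j <= Kd (i + j)%N)%VS,
        directv (\sum_(i < m.+1) Kd i)%VS &
        K = (\sum_(i < m.+1) Kd i)%VS].

(* G = Z_n x Z_n is written additively: (g^i, g^j) is (i, j), for n >= 2. *)
Notation ZZ n := ('Z_n * 'Z_n)%type.

Definition multiplicative_char (n : nat) (k : fieldType) (chi : ZZ n -> k) :=
  chi 0 = 1 /\ forall f f', chi (f + f') = chi f * chi f'.

(* The G-action on V_1 (+) V_2 is diagonal in the basis x, y, so it is given by
   two weights: f.x = (a1 f) x and f.y = (a2 f) y. *)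
Definition dot1 (n : nat) (k : fieldType) (q : k) (f : ZZ n) : k := q ^+ f.1.
Definition dot2 (n : nat) (k : fieldType) (q : k) (f : ZZ n) : k := q ^+ f.2.

Definition rhd1 (n : nat) (k : fieldType) (q : k) (chi1 : ZZ n -> k)
  (f : ZZ n) : k := chi1 f * dot1 q f.
Definition rhd2 (n : nat) (k : fieldType) (q : k) (chi2 : ZZ n -> k)
  (f : ZZ n) : k := chi2 f * dot2 q f.

(* Relations with weights a1, a2 and xy = c yx; gam is the image of G. *)
Definition satisfies_relations (n : nat) (k : fieldType) (a1 a2 : ZZ n -> k)
    (c : k) (B : algType k) (gam : ZZ n -> B) (x y : B) : Prop :=
  (gam 0 = 1 /\ forall f f', gam (f + f') = gam f * gam f') /\
  [/\ x ^+ n = 0, y ^+ n = 0, x * y = c *: (y * x),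
      forall f, gam f * x = (a1 f *: x) * gam f &
      forall f, gam f * y = (a2 f *: y) * gam f].

Definition is_presented (n : nat) (k : fieldType) (a1 a2 : ZZ n -> k) (c : k)
    (A : algType k) (gam : ZZ n -> A) (x y : A) : Prop :=
  satisfies_relations a1 a2 c gam x y /\
  forall (B : algType k) (gam' : ZZ n -> B) (x' y' : B),
    satisfies_relations a1 a2 c gam' x' y' ->
    exists phi : {lrmorphism A -> B},
      [/\ forall f, phi (gam f) = gam' f, phi x = x' & phi y = y'] /\
      (forall psi : {lrmorphism A -> B},
         [/\ forall f, psi (gam f) = gam' f, psi x = x' & psi y = y'] ->
         psi =1 phi).

(* The presented algebra is spanned by the monomials x^a y^b f with a, b < n, so
   requiring a finite dimensional H loses nothing.  That the coproduct below is
   well defined constrains the weights: x^n = 0 forces a1 (1, 0) to be a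
   primitive n-th root of unity, and y^n = 0 forces the same of a2 (0, -1). *)
Definition is_hopf_presented (n : nat) (k : fieldType) (a1 a2 : ZZ n -> k)
    (c : k) (H : hopfAlgebra k) (gam : ZZ n -> H) (x y : H) : Prop :=
  [/\ is_presented a1 a2 c gam x y,
      comul H x = tens x 1 + tens (gam (1, 0)) x,
      comul H y = tens y 1 + tens (gam (0, -1)) y &
      forall f, comul H (gam f) = tens (gam f) (gam f)].

(* H = T_q (x) T_{q^-1} *)
Definition is_taft_tensor (n : nat) (k : fieldType) (q : k)
    (H : hopfAlgebra k) (gam : ZZ n -> H) (x y : H) : Prop :=
  is_hopf_presented (@dot1 n k q) (@dot2 n k q) 1 gam x y.

(* H_(chi1, chi2) *)
Definition is_taft_twist (n : nat) (k : fieldType) (q : k)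
    (chi1 chi2 : ZZ n -> k) (H : hopfAlgebra k) (gam : ZZ n -> H) (x y : H) :
    Prop :=
  is_hopf_presented (rhd1 q chi1) (rhd2 q chi2) (chi2 (1, 0)) gam x y.

(* The grading with deg f = 0 for f in G and deg x = deg y = 1: degree i is
   spanned by the words with exactly i letters in {x, y}.  The top nonzero
   degree is 2(n - 1). *)
Definition taft_degree (n : nat) (k : fieldType) (H : falgType k)
    (gam : ZZ n -> H) (x y : H) (i : nat) : {vspace H} :=
  let kG := <<codom gam>>%VS in
  (kG * (<<[:: x; y]>> * kG) ^+ i)%VS.

Definition taft_top (n : nat) : nat := (2 * n.-1)%N.

(* V_1 (+) V_2 in the coordinates given by the basis x, y. *)
Notation VV k := ((k : fieldType)^o * (k : fieldType)^o)%type.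

Definition V1 (k : fieldType) : {vspace VV k} := <[(1, 0)%R]>%VS.
Definition V2 (k : fieldType) : {vspace VV k} := <[(0, 1)%R]>%VS.

Definition diag_act (n : nat) (k : fieldType) (a1 a2 : ZZ n -> k) (f : ZZ n)
  (w : VV k) : VV k := (a1 f *: w.1, a2 f *: w.2).

Definition invariant_under (n : nat) (k : fieldType) (a1 a2 : ZZ n -> k)
    (F : {group ZZ n}) (U : {vspace VV k}) : Prop :=
  forall f w, f \in F -> w \in U -> diag_act a1 a2 f w \in U.

Record coideal_datum (n : nat) (k : fieldType) (a1 a2 : ZZ n -> k)
    (W1 W2 W3 : {vspace VV k}) (F : {group ZZ n}) : Prop := CoidealDatum {
  datum_direct : directv (W1 + W2 + W3);
  datum_W1 : ((W1 + W2 + W3) :&: V1 k)%VS = W1;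
  datum_W2 : ((W1 + W2 + W3) :&: V2 k)%VS = W2;
  datum_W3 : (W3 :&: (W1 + W2) = 0)%VS;
  datum_W3_V1 : (W3 :&: V1 k = 0)%VS;
  datum_W3_V2 : (W3 :&: V2 k = 0)%VS;
  datum_inv1 : invariant_under a1 a2 F W1;
  datum_inv2 : invariant_under a1 a2 F W2;
  datum_inv3 : invariant_under a1 a2 F W3;
  datum_gg : W3 != 0%VS -> (1, 1) \in F
}.

(* The linear map V_1 (+) V_2 -> H with x |-> a and y |-> b. *)
Definition lin2 (k : fieldType) (H : falgType k) (a b : H) (w : VV k) : H :=
  w.1 *: a + w.2 *: b.

Lemma lin2_is_linear (k : fieldType) (H : falgType k) (a b : H) :
  linear (lin2 a b).
Proof.
by move=> c u v; rewrite /lin2 /= !scalerDl scalerDr !scalerA addrACA.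
Qed.

HB.instance Definition _ (k : fieldType) (H : falgType k) (a b : H) :=
  GRing.isLinear.Build k (VV k) H *:%R (lin2 a b) (lin2_is_linear a b).

Definition bracket (n : nat) (k : fieldType) (H : falgType k)
    (gam : ZZ n -> H) (x y : H) : 'Hom(VV k, H) :=
  linfun (lin2 x (y * gam (1, 1))).

Definition bracket_tilde (n : nat) (k : fieldType) (H : falgType k)
    (gam : ZZ n -> H) (x y : H) : 'Hom(VV k, H) :=
  linfun (lin2 (x * gam (-1, -1)) y).

Definition datum_algebra (n : nat) (k : fieldType) (H : falgType k)
    (gam : ZZ n -> H) (x y : H) (W1 W2 W3 : {vspace VV k}) (F : {group ZZ n}) :
    {vspace H} :=
  agenv (<<[seq gam f | f in F]>> + (linfun (lin2 x y) @: (W1 + W2))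
         + (bracket gam x y @: W3) + (bracket_tilde gam x y @: W3))%VS.

(* Main.v *)
Require Import Defs.
From mathcomp Require Import all_boot all_order all_algebra all_fingroup all_field.
From HB Require Import structures.
From mathcomp Require Import sesquilinear.
Import GRing.Theory.
Local Open Scope ring_scope.

(* A representation rho of H sends h to the matrix sum rho(h_(1)) h_(2) over H.
   This map is multiplicative, and its entries preserve every left coideal
   subalgebra K.  Characters of G give commuting diagonalizable operators, which
   split an element of K of degree d into elements of K of the form
     z = sum_a C_a x^a y^(d-a) f_0 h^(d-a),    h = (g, g),
   and the two-dimensional representations give skew derivations d/dx, d/dy.
   Lowering z to degree 0 shows that f_0 h^(d-a) is in K whenever C_a != 0, and
   lowering it to degree 1 gives an element
     s C_(a+1) x f_0 h^b + t C_a y f_0 h^(b+1),    a + b = d - 1,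
   of K with s, t != 0.  If x or y is in K, all the factors of each term of z
   are thus in K.  Otherwise C_a and C_(a+1) vanish together, so that z is
   determined by C_d, and z is a multiple of w^d f_0, where w = r x + r' y h is
   in K.
   Nowhere is the linear independence of the monomials needed. *)

Set Implicit Arguments.
Unset Strict Implicit.
Unset Printing Implicit Defensive.

(** * Operators on [H] from matrix coefficients of its representations *)

Section Coaction.
Variables (k : fieldType) (H : hopfAlgebra k).

Fact tens_is_bilinear :
  bilinear_for (GRing.Scale.Law.clone _ _ *:%R _)
    (GRing.Scale.Law.clone _ _ *:%R _) (@tens k H).
Proof.
split=> [b s a a'|a s b b'] /=.
  by rewrite /applyr /tens linearP /= mulrDl scalerAl.
by rewrite /tens linearP /= mulrDr scalerAr.
Qed.
HB.instance Definition _ := bilinear_isBilinear.Build k H H (hopf_sq H) _ _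
  (@tens k H) tens_is_bilinear.

Definition slice (lam : {linear H -> k^o}) (a b : H) : H := (lam a : k) *: b.

Fact slice_is_bilinear (lam : {linear H -> k^o}) :
  bilinear_for (GRing.Scale.Law.clone _ _ *:%R _)
    (GRing.Scale.Law.clone _ _ *:%R _) (slice lam).
Proof.
split=> [b s a a'|a s b b'] /=.
  by rewrite /applyr /slice linearP /= scalerDl scalerA.
by rewrite /slice scalerDr !scalerA mulrC.
Qed.
HB.instance Definition _ lam := bilinear_isBilinear.Build k H H H _ _
  (slice lam) (slice_is_bilinear lam).

(** By uniqueness in the universal property: the identity and the projection onto the product
    subspace agree on simple tensors, hence coincide. *)
Lemma tens_span : (limg (hopf_inl H) * limg (hopf_inr H) = fullv)%VS.
Proof.
have [_ /(_ (hopf_sq H) (@tens k H)) [f [_ f_uniq]]] := hopf_sqP H.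
set U := (_ * _)%VS.
have idE := f_uniq (idfun : {linear _ -> _}) (fun a b => erefl).
have prE := f_uniq (projv U : {linear _ -> _}) _.
apply/eqP; rewrite eqEsubv subvf; apply/subvP => t _.
suff <- : projv U t = t by apply: memv_proj.
rewrite (prE _ t) -?idE // => a b.
by rewrite /= projv_id // memv_mul ?memv_img ?memvf.
Qed.

Lemma tens_ext (f g : 'Hom(hopf_sq H, H)) :
  (forall a b, f (tens a b) = g (tens a b)) -> f = g.
Proof.
move=> eq_fg; apply/lfunP => t; apply/eqP.
rewrite -subr_eq0 -opp_lfunE -add_lfunE.
rewrite -memv_ker; have: t \in fullv by rewrite memvf.
rewrite -tens_span; apply/subvP/prodvP => u v.
move=> /memv_imgP[a _ ->] /memv_imgP[b _ ->].
by rewrite memv_ker add_lfunE opp_lfunE [X in X - _]eq_fg subrr.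
Qed.

Lemma slice_exists (lam : {linear H -> k^o}) :
  exists f : 'Hom(hopf_sq H, H), forall a b, f (tens a b) = (lam a : k) *: b.
Proof.
have [_ /(_ H (slice lam)) [f [fE _]]] := hopf_sqP H.
by exists (linfun f) => a b; rewrite lfunE /= fE.
Qed.

Lemma tensM (a b a' b' : H) : tens a b * tens a' b' = tens (a * a') (b * b').
Proof.
have [com _] := hopf_sqP H.
by rewrite /tens !rmorphM /= -!mulrA; congr (_ * _); rewrite !mulrA com.
Qed.

(** Stability is asked for all [K] at once, since the operators below are built from [H] alone. *)
Definition coideal_stable (D : 'End(H)) :=
  forall K, left_coideal_subalgebra K -> forall z, z \in K -> D z \in K.

(* L i j h = sum (rho (h_(1)) i j) h_(2) *)
Lemma coaction_exists (N : nat) (rho : {lrmorphism H -> 'M[k]_N.+1}) :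
  exists L : 'I_N.+1 -> 'I_N.+1 -> 'End(H),
  [/\ forall i j a b, L i j (a * b) = \sum_l L i l a * L l j b,
      forall i j, coideal_stable (L i j),
      forall i j z (g : H), comul H z = tens z 1 + tens g z ->
        L i j z = (rho z i j)%:A + rho g i j *: z
    & forall i j g, comul H g = tens g g -> L i j g = rho g i j *: g].
Proof.
pose lam i j a : k^o := rho a i j.
have lamP i j : linear (lam i j) by move=> s a b; rewrite /lam linearP !mxE.
pose Lam i j : {linear H -> k^o} :=
  HB.pack (lam i j) (GRing.isLinear.Build k H k^o *:%R (lam i j) (lamP i j)).
have [F FE] : exists F : 'I_N.+1 -> 'I_N.+1 -> 'Hom(hopf_sq H, H),
    forall i j a b, F i j (tens a b) = (rho a i j) *: b.
  have [F FE] := fin_all_exists (fun ij => slice_exists (Lam ij.1 ij.2)).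
  by exists (fun i j => F (i, j)) => i j a b; rewrite FE.
(* Multiplicativity of [rho] read on tensors. It is checked on simple ones, first in [s] with [t]
   fixed, then in [t]. *)
have FM i j s t : F i j (s * t) = \sum_l F i l s * F l j t.
  suff /(congr1 (fun f : 'Hom(_, _) => f s)) :
      (F i j \o amulr t)%VF = \sum_l (amulr (F l j t) \o F i l)%VF.
    rewrite sum_lfunE comp_lfunE lfunE /= => ->.
    by apply: eq_bigr => l _; rewrite comp_lfunE lfunE.
  apply: tens_ext => a b; rewrite sum_lfunE comp_lfunE lfunE /=.
  suff /(congr1 (fun f : 'Hom(_, _) => f t)) :
      (F i j \o amull (tens a b))%VF
        = \sum_l (amull (rho a i l *: b) \o F l j)%VF.
    rewrite sum_lfunE comp_lfunE lfunE /= => ->.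
    by apply: eq_bigr => l _; rewrite !comp_lfunE !lfunE /= FE.
  apply: tens_ext => a' b'; rewrite sum_lfunE comp_lfunE lfunE /=.
  rewrite tensM FE rmorphM mxE scaler_suml; apply: eq_bigr => l _.
  by rewrite comp_lfunE lfunE /= FE -scalerAr -scalerAl scalerA mulrC.
exists (fun i j => (F i j \o comul H)%VF); split.
- move=> i j a b; rewrite comp_lfunE rmorphM /= FM.
  by apply: eq_bigr => l _; rewrite !comp_lfunE.
- move=> i j K [_ _ KP] z zK; rewrite comp_lfunE.
  (* [comul] sends [K] into the tensor product of [H] and [K]; [F i j] turns the left factor into a
     scalar and leaves the right one, which is in [K]. *)
  have: comul H z \in (F i j @^-1: K)%VS; last by rewrite -memv_preim.
  apply: (subvP _ _ (memv_img (comul H) zK)); apply: (subv_trans KP).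
  apply/prodvP => _ _ /memv_imgP[a _ ->] /memv_imgP[b bK ->].
  by rewrite -memv_preim FE memvZ.
- by move=> i j z g zE; rewrite comp_lfunE zE linearD /= !FE.
- by move=> i j g gE; rewrite comp_lfunE gE FE.
Qed.

End Coaction.

(** * Gaussian binomial coefficients at roots of unity *)

Section QBinomial.
Variable k : fieldType.

(* The coefficient of 'X^j is, up to a unit, the q-binomial coefficient
   (m choose j). *)
Definition gauss_poly (z : k) (m : nat) : {poly k} :=
  \prod_(i < m) (1 - z ^+ i *: 'X).

(** A q-Pascal rule, from splitting off the first factor: the product for [m.+1] is 1 - X times the
    product for [m] taken at zX. This form is the one that the Jordan blocks below produce. *)
Lemma coef_gauss_polyS (z : k) m j :
  (gauss_poly z m.+1)`_j =
    z ^+ j * (gauss_poly z m)`_j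
    - (if j is j'.+1 then z ^+ j' * (gauss_poly z m)`_j' else 0).
Proof.
have coefZX (p : {poly k}) i : (p \Po (z *: 'X))`_i = z ^+ i * p`_i.
  rewrite comp_polyE coef_sum; under eq_bigr do rewrite exprZn !coefZ coefXn.
  have [lt_ip|le_pi] := ltnP i (size p); last first.
    rewrite (nth_default _ le_pi) mulr0 big1 // => l _.
    by rewrite gtn_eqF ?mulr0 // (leq_trans (ltn_ord l)).
  rewrite (bigD1 (Ordinal lt_ip)) //= eqxx mulr1 mulrC big1 ?addr0 // => l.
  by rewrite -val_eqE /= eq_sym => /negbTE ->; rewrite !mulr0.
have -> : gauss_poly z m.+1 = (1 - 'X) * (gauss_poly z m \Po (z *: 'X)).
  rewrite /gauss_poly big_ord_recl expr0 scale1r rmorph_prod /=; congr (_ * _).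
  apply: eq_bigr => i _; rewrite rmorphB /= rmorph1 comp_polyZ comp_polyX.
  by rewrite scalerA exprSr.
rewrite mulrBl mul1r coefB coefXM coefZX; congr (_ - _).
by case: j => //= j; rewrite coefZX.
Qed.

Lemma gauss_poly_gt z m j : (m < j)%N -> (gauss_poly z m)`_j = 0.
Proof.
elim: m j => [|m IHm] [|j] // lt_mj.
  by rewrite /gauss_poly big_ord0 coef1.
by rewrite coef_gauss_polyS !IHm ?mulr0 ?subrr // ltnW.
Qed.

Lemma gauss_poly_top z m : z != 0 -> (gauss_poly z m)`_m != 0.
Proof.
move=> nz_z; elim: m => [|m IHm].
  by rewrite /gauss_poly big_ord0 coef1 oner_neq0.
rewrite coef_gauss_polyS gauss_poly_gt // mulr0 sub0r oppr_eq0.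
by rewrite mulf_neq0 ?expf_neq0.
Qed.

(** Over d e indices the product is the [e]-th power of the product over one period, which is a unit
    times X^d - 1; the coefficient of X^d in (X^d - 1)^e is [e] up to sign. *)
Lemma gauss_poly_prim_neq0 (z : k) d e :
  d.-primitive_root z -> e%:R != 0 :> k -> (gauss_poly z (d * e))`_d != 0.
Proof.
move=> prim_z nz_e; have d_gt0 := prim_order_gt0 prim_z.
have nz_z : z != 0 by rewrite (prim_root_eq0 prim_z) -lt0n.
have powE : gauss_poly z (d * e) = gauss_poly z d ^+ e.
  elim: e {nz_e} => [|e IHe]; first by rewrite muln0 /gauss_poly big_ord0.
  rewrite mulnS addnC exprSr -IHe /gauss_poly big_split_ord; congr (_ * _).
  apply: eq_bigr => i _; rewrite /= exprD exprM (prim_expr_order prim_z).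
  by rewrite expr1n mul1r.
have [s nz_s gE] : exists2 s, s != 0 & gauss_poly z d = s *: ('X^d - 1).
  (* The factor 1 - z^i X has root z^(-i), so X^d - 1 is factored along the powers of [z^-1]. *)
  have prim_zV : d.-primitive_root z^-1.
    have <- : z ^+ d.-1 = z^-1.
      apply: (mulfI nz_z); rewrite -exprS prednK //.
      by rewrite (prim_expr_order prim_z) mulfV.
    rewrite prim_root_exp_coprime // coprime_sym -{1}(prednK d_gt0).
    exact: coprimeSn.
  exists (\prod_(i < d) - z ^+ i).
    by apply/prodf_neq0 => i _; rewrite oppr_eq0 expf_neq0.
  rewrite -(factor_Xn_sub_1 prim_zV) big_mkord -scaler_prod /gauss_poly.
  apply: eq_bigr => i _; rewrite scalerBr exprVn scaleNr.
  rewrite -[_ *: _%:P]mul_polyC -polyCM.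
  by rewrite mulNr mulfV ?expf_neq0 // polyCN opprK addrC.
have coefE : forall m, ((('X^d - 1) ^+ m : {poly k})`_0 = (-1) ^+ m)
    /\ ((('X^d - 1) ^+ m : {poly k})`_d = - ((-1) ^+ m * m%:R)).
  elim=> [|m [IH0 IHd]].
    by rewrite !expr0 !coef1 eqxx (gtn_eqF d_gt0) mulr0 oppr0.
  rewrite exprSr !mulrBr !mulr1 !coefB !coefMXn d_gt0 ltnn subnn IH0 IHd.
  rewrite sub0r exprSr mulrN1; split=> //.
  by rewrite -natr1 mulrDr mulr1 !mulNr !opprD !opprK addrC.
rewrite powE gE exprZn coefZ (coefE e).2 mulf_neq0 ?expf_neq0 // oppr_eq0.
by rewrite mulf_neq0 // expf_neq0 // oppr_eq0 oner_neq0.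
Qed.

Lemma gauss_poly0 (z : k) m : (gauss_poly z m)`_0 = 1.
Proof.
elim: m => [|m IHm]; first by rewrite /gauss_poly big_ord0 coef1.
by rewrite coef_gauss_polyS IHm subr0 mulr1.
Qed.

(** The linear coefficient is -(1 + z + ... + z^(m-1)), so [z - 1] times it is 1 - z^m. *)
Lemma gauss_poly1_neq0 (z : k) n m :
  n.-primitive_root z -> (0 < m < n)%N -> (gauss_poly z m)`_1 != 0.
Proof.
move=> prim_z /andP[m_gt0 lt_mn].
have gE : (z - 1) * (gauss_poly z m)`_1 = 1 - z ^+ m.
  elim: m {m_gt0 lt_mn} => [|m IHm].
    by rewrite /gauss_poly big_ord0 coef1 mulr0 subrr.
  rewrite coef_gauss_polyS gauss_poly0 mulr1 mulrBr mulrCA IHm.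
  by rewrite mulr1 mulrBr mulr1 -exprS opprB addrC addrA subrK.
apply: contraTneq (lt_mn) => g0; move/eqP: gE.
rewrite g0 mulr0 eq_sym subr_eq0 eq_sym -(prim_order_dvd prim_z) -leqNgt.
exact: dvdn_leq.
Qed.

End QBinomial.

(** * Jordan block representations of the presented algebra *)

Section JordanRep.
Variables (n : nat) (k : fieldType) (a1 a2 : ZZ n -> k) (c : k).

(** The subdiagonal weights are chosen to reproduce the recursion of [coef_gauss_polyS]. *)
Definition jordan_block N (z : k) : 'M[k]_N.+1 :=
  \matrix_(i, j) (- z ^+ j *+ (i == j.+1 :> nat)).

Lemma jordan_block_nilp N z : (N.+1 <= n)%N -> jordan_block N z ^+ n = 0.
Proof.
move=> le_Nn.
have low m (i j : 'I_N.+1) : (i < j + m)%N -> (jordan_block N z ^+ m) i j = 0.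
  elim: m i j => [|m IHm] i j lt_i.
    by rewrite addn0 in lt_i; rewrite expr0 mxE -val_eqE ltn_eqF.
  rewrite exprSr mxE big1 // => l _; rewrite [X in _ * X]mxE.
  have [lE|] := eqVneq (l : nat) j.+1; last by rewrite mulr0n mulr0.
  by rewrite IHm ?mul0r // lE addSnnS.
apply/matrixP => i j; rewrite low ?mxE // (leq_trans (ltn_ord i)) //.
by rewrite (leq_trans le_Nn) ?leq_addl.
Qed.

(** As [y] acts by 0, its relations are immediate. Each [x] shifts the basis by one and multiplies
    the weight of [G] by [a1]; size at most [n] gives x^n = 0. *)
Lemma jordan_rep (A : algType k) (gam : ZZ n -> A) (x y : A) (chi : ZZ n -> k)
    (N : nat) (z : k) :
  (N.+1 <= n)%N -> multiplicative_char a1 -> multiplicative_char chi ->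
  is_presented a1 a2 c gam x y ->
  exists rho : {lrmorphism A -> 'M[k]_N.+1},
    [/\ forall f, rho (gam f) = diag_mx (\row_i (chi f * a1 f ^+ i)),
        rho x = jordan_block N z & rho y = 0].
Proof.
move=> le_Nn [a10 a1D] [chi0 chiD] [_].
have rel : satisfies_relations a1 a2 c
    (fun f => diag_mx (\row_(i < N.+1) (chi f * a1 f ^+ i)))
    (jordan_block N z) 0.
  split; first split.
  - apply/matrixP => i j; rewrite !mxE; case: eqP => //= ->.
    by rewrite a10 chi0 expr1n mulr1.
  - move=> f f'; rewrite -mulmxE mulmx_diag; congr diag_mx.
    by apply/rowP => i; rewrite !mxE chiD a1D exprMn mulrACA.
  split; first exact: jordan_block_nilp.
  - by rewrite expr0n; case: (n) le_Nn.
  - by rewrite mulr0 mul0r scaler0.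
  - move=> f; rewrite -mulmxE mul_diag_mx mul_mx_diag.
    apply/matrixP => i j; rewrite !mxE.
    have [->|_] := eqVneq (i : nat) j.+1; last by rewrite !mulr0n !mulr0 mul0r.
    rewrite !mulr1n exprS mulrCA -!mulrA; congr (_ * _).
    by rewrite mulrA mulrC.
  - by move=> f; rewrite scaler0 mulr0 mul0r.
by move=> /(_ _ _ _ _ rel) [rho [rhoP _]]; exists rho; case: rhoP.
Qed.

End JordanRep.

(** * Characters of [G], and the exchange of [x] and [y] *)

Lemma multiplicative_charX n (k : fieldType) (chi : ZZ n -> k) f m :
  multiplicative_char chi -> chi (f *+ m) = chi f ^+ m.
Proof.
move=> [chi0 chiD]; elim: m => [|m IHm]; first by rewrite mulr0n chi0.
by rewrite mulrS chiD IHm exprS.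
Qed.

Lemma multiplicative_char_neq0 n (k : fieldType) (chi : ZZ n -> k) f :
  multiplicative_char chi -> chi f != 0.
Proof.
move=> [chi0 chiD]; apply: contraTneq (oner_neq0 k) => chif0.
by rewrite -chi0 -(subrr f) chiD chif0 mul0r eqxx.
Qed.

Lemma ZZ_mulrn n (f : ZZ n) : (2 <= n)%N -> f *+ n = 0.
Proof.
move=> n_ge2; have Zn (u : 'Z_n) : u *+ n = 0.
  by rewrite -mulr_natr pchar_Zp ?mulr0.
have pairE m : f *+ m = (f.1 *+ m, f.2 *+ m).
  by elim: m => // m IHm; rewrite !mulrS IHm.
by rewrite pairE !Zn.
Qed.

(** Results proved for [x] carry over to [y] through this symmetry. *)
Lemma is_presented_swap n (k : fieldType) (a1 a2 : ZZ n -> k) (c : k)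
    (A : algType k) (gam : ZZ n -> A) (x y : A) :
  c != 0 -> is_presented a1 a2 c gam x y -> is_presented a2 a1 c^-1 gam y x.
Proof.
move=> nz_c [[gamP [xn yn xy fx fy]] univ]; split.
  by split=> //; split=> //; rewrite xy scalerA mulVf // scale1r.
move=> B gam' y' x' [gamP' [yn' xn' yx' fy' fx']].
have rel : satisfies_relations a1 a2 c gam' x' y'.
  by split=> //; split=> //; rewrite yx' scalerA mulfV // scale1r.
have [phi [[phig phix phiy] phi_uniq]] := univ _ _ _ _ rel.
by exists phi; split=> // psi [psig psiy psix]; apply: phi_uniq.
Qed.

(** * Eigenoperators and divided derivations *)

Section Operators.
Variables (n : nat) (k : fieldType) (a1 a2 : ZZ n -> k) (c : k).
Variables (H : hopfAlgebra k) (gam : ZZ n -> H) (x y : H) (g g' : ZZ n).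
Hypothesis a1_char : multiplicative_char a1.
Hypothesis presH : is_presented a1 a2 c gam x y.
Hypothesis comul_x : comul H x = tens x 1 + tens (gam g) x.
Hypothesis comul_y : comul H y = tens y 1 + tens (gam g') y.
Hypothesis comul_gam : forall f, comul H (gam f) = tens (gam f) (gam f).

Definition monomial a b f : H := x ^+ a * y ^+ b * gam f.

(** The 1-by-1 block is a character of [G] extended by 0 on [x] and [y]. Its operator is
    multiplicative and scales [x], [y] and [gam f] by the values of [chi] at [g], [g'] and [f]. *)
Lemma eigen_operator (chi : ZZ n -> k) : (0 < n)%N -> multiplicative_char chi ->
  exists E : 'End(H),
    coideal_stable E /\
    forall a b f,
      E (monomial a b f) = chi (g *+ a + g' *+ b + f) *: monomial a b f.
Proof.
move=> n_gt0 chiP; have [chi0 chiD] := chiP.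
have [rho [rhog rhox rhoy]] :=
  jordan_rep 0 n_gt0 a1_char chiP presH.
have [L [LM LK Lp Lg]] := coaction_exists rho.
exists (L 0 0); split=> [|a b f]; first exact: LK.
have EM u v : L 0 0 (u * v) = L 0 0 u * L 0 0 v by rewrite LM big_ord1.
have Egam h : L 0 0 (gam h) = chi h *: gam h.
  by rewrite Lg // rhog !mxE eqxx expr0 mulr1.
have Ex : L 0 0 x = chi g *: x.
  rewrite (Lp _ _ _ _ comul_x) rhog rhox !mxE eqxx expr0 mulr1.
  by rewrite mulr0n scale0r add0r.
have Ey : L 0 0 y = chi g' *: y.
  by rewrite (Lp _ _ _ _ comul_y) rhog rhoy !mxE eqxx expr0 mulr1 scale0r add0r.
have EX u s m : L 0 0 u = s *: u -> L 0 0 (u ^+ m.+1) = s ^+ m.+1 *: u ^+ m.+1.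
  move=> uE; elim: m => // m IHm.
  by rewrite exprS EM IHm uE -scalerAl -scalerAr scalerA -exprS.
have E1 : L 0 0 1 = 1.
  by have [[[<- _] _] _] := presH; rewrite Egam chi0 scale1r.
have EX0 u s m : L 0 0 u = s *: u -> L 0 0 (u ^+ m) = s ^+ m *: u ^+ m.
  by case: m => [|m]; [rewrite !expr0 scale1r E1|apply: EX].
rewrite /monomial !EM Egam (EX0 _ _ _ Ex) (EX0 _ _ _ Ey).
rewrite -!scalerAl -!scalerAr -!scalerAl !scalerA !chiD.
by rewrite !multiplicative_charX // mulrAC.
Qed.

(** [D j] is entry (j, 0) of the coaction for the block with parameter [a1 g]. On products y^b f
    only the entry at [j] = 0 survives, and each further factor [x] is one step of the q-Pascal
    rule. *)
Lemma divided_derivation N : (N.+1 <= n)%N ->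
  exists D : 'I_N.+1 -> 'End(H),
    (forall j, coideal_stable (D j)) /\
    forall j a b f,
      D j (monomial a b f) = (gauss_poly (a1 g) a)`_j *: monomial (a - j) b f.
Proof.
move=> le_Nn; have [a10 a1D] := a1_char.
have one_char : multiplicative_char (fun _ : ZZ n => 1 : k).
  by split=> // *; rewrite mulr1.
have [rho [rhog rhox rhoy]] :=
  jordan_rep (a1 g) le_Nn a1_char one_char presH.
have [L [LM LK Lp Lg]] := coaction_exists rho.
exists (fun j => L j 0); split=> [j|j a b f]; first exact: LK.
have diagE h i j' : rho (gam h) i j' = a1 h ^+ i *+ (i == j').
  by rewrite rhog !mxE mul1r.
have Lgam i h : L i 0 (gam h) = (i == 0)%:R *: gam h.
  rewrite Lg // diagE; have [->|_] := eqVneq i 0; last by rewrite mulr0n.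
  by rewrite expr0.
have Ly i h m : L i 0 (y ^+ m * gam h) = (i == 0)%:R *: (y ^+ m * gam h).
  elim: m => [|m IHm]; first by rewrite expr0 mul1r Lgam.
  rewrite exprS -mulrA LM (bigD1 i) //= big1 ?addr0 => [|l ne_li]; last first.
    rewrite (Lp _ _ _ _ comul_y) rhoy diagE mxE scale0r add0r.
    by rewrite eq_sym (negbTE ne_li) mulr0n scale0r mul0r.
  rewrite (Lp _ _ _ _ comul_y) rhoy diagE mxE scale0r add0r eqxx IHm.
  have [->|_] := eqVneq i 0; last by rewrite scale0r mulr0 scale0r.
  by rewrite expr0 mulr1n !scale1r.
rewrite /monomial -!mulrA; set w := y ^+ b * gam f.
elim: a j => [|a IHa] j.
  rewrite expr0 mul1r Ly /gauss_poly big_ord0 coef1.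
  by [].
rewrite exprS -mulrA LM coef_gauss_polyS.
have LxE i l : L i l x = - (a1 g) ^+ l *+ (i == l.+1 :> nat) *: 1
    + (a1 g ^+ i *+ (i == l)) *: x.
  by rewrite (Lp _ _ _ _ comul_x) rhox mxE diagE.
under eq_bigr do rewrite LxE IHa.
(* [rho x] is subdiagonal and [rho (gam g)] diagonal, so only the indices j and j - 1 contribute. *)
rewrite (bigD1 j) //= eqxx ltn_eqF // mulr0n scale0r add0r mulr1n.
rewrite scalerBl; congr (_ + _).
  rewrite -scalerAl -scalerAr scalerA mulrA -exprS.
  (* For [j] > [a] the truncated subtraction gives a wrong exponent, but the coefficient is 0. *)
  have [le_ja|lt_aj] := leqP j a; first by rewrite subSn.
  by rewrite gauss_poly_gt // mulr0 !scale0r.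
case jE: (j : nat) => [|j'] /=.
  rewrite [in RHS]scale0r oppr0 big1 // => l ne_lj.
  by rewrite eq_sym (negbTE ne_lj) !mulr0n !scale0r addr0 mul0r.
have lt_j' : (j' < N.+1)%N by rewrite ltnW // -jE.
have ne_jj' : Ordinal lt_j' != j by rewrite -val_eqE /= jE ltn_eqF.
rewrite (bigD1 (Ordinal lt_j')) //= eqxx (eq_sym j) (negbTE ne_jj').
rewrite mulr1n mulr0n scale0r addr0 subSS -scalerAl mul1r scalerA mulNr scaleNr.
rewrite big1 ?addr0 // => l /andP[ne_lj]; rewrite -val_eqE /= => ne_lj'.
rewrite eqSS (eq_sym j') (negbTE ne_lj') eq_sym (negbTE ne_lj).
by rewrite !mulr0n !scale0r addr0 mul0r.
Qed.

(* Otherwise a1 g has order d < n, and applying the d-th divided derivation to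
   x^n = 0 gives x^(n - d) = 0. *)
Lemma prim_weight :
  (2 <= n)%N -> [pchar k] =i pred0 -> n.-primitive_root (a1 g).
Proof.
move=> n_ge2 char0; have n_gt0 : (0 < n)%N by apply: ltnW.
have [[[gam0 _] [xn _ _ _ _]] _] := presH.
have [||d prim_d] := @prim_order_exists k n (a1 g) => //.
  by rewrite -(multiplicative_charX g n a1_char) ZZ_mulrn // a1_char.1.
case/dvdnP => e nE; have d_gt0 := prim_order_gt0 prim_d.
have [->//|ne_nd] := eqVneq n d; exfalso.
have nz_e : e%:R != 0 :> k.
  by have /pcharf0P -> := char0; apply: contraTneq n_gt0 => e0; rewrite nE e0.
have lt_dn : (d < n)%N.
  rewrite ltn_neqAle eq_sym ne_nd; apply: dvdn_leq n_gt0 _.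
  by apply/dvdnP; exists e.
have [N NE] : exists N, n = N.+1 by exists n.-1; rewrite prednK.
have [D [_ DE]] := divided_derivation (eq_leq (esym NE)).
have monoX m : monomial m 0 0 = x ^+ m by rewrite /monomial expr0 gam0 !mulr1.
have xm0 : x ^+ (n - d) = 0.
  have := DE (inord d) n 0 0; rewrite !monoX xn linear0 inordK -?NE //.
  move/esym/eqP; rewrite scaler_eq0 [in gauss_poly _ _]nE mulnC.
  by rewrite (negbTE (gauss_poly_prim_neq0 prim_d nz_e)) => /eqP.
(* Lowering x^(n-d) = 0 completely leaves a nonzero multiple of 1, a contradiction. *)
have := DE (inord (n - d)) (n - d)%N 0 0; rewrite !monoX xm0 linear0.
rewrite inordK -?NE ?ltn_subrL ?d_gt0 // subnn expr0.
move/esym/eqP; rewrite scaler_eq0 oner_eq0 orbF.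
by rewrite (negbTE (gauss_poly_top _ _)) // multiplicative_char_neq0.
Qed.

End Operators.

(** * Eigencomponents and spans *)

(** Induction on the number of terms with a wrong eigenvalue: (E - nu) / (mu0 - nu) removes the
    terms of eigenvalue [nu] and fixes those of eigenvalue [mu0]. *)
Lemma eigen_component (k : fieldType) (V : vectType k) (E : 'End(V))
    (K : {vspace V}) (I : finType) (P : pred I) (m : I -> V) (mu : I -> k) :
  (forall z, z \in K -> E z \in K) -> (forall i, E (m i) = mu i *: m i) ->
  \sum_(i | P i) m i \in K ->
  forall mu0, \sum_(i | P i && (mu i == mu0)) m i \in K.
Proof.
move=> EK + + mu0; have [N] := ubnP #|[pred i | P i && (mu i != mu0)]|.
elim: N P m => // N IHN P m lt_N Em mK.
have [|] := boolP [exists i, P i && (mu i != mu0)]; last first.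
  move/existsPn => muE; rewrite (eq_bigl P) // => i.
  by have := muE i; case: (P i) => //=; rewrite negbK => ->.
case/existsP => i0 /andP[Pi0 ne_i0]; set nu := mu i0 in ne_i0.
have nz_nu : mu0 - nu != 0 by rewrite subr_eq0 eq_sym.
pose m' i := ((mu i - nu) / (mu0 - nu)) *: m i.
have -> : \sum_(i | P i && (mu i == mu0)) m i
    = \sum_(i | (P i && (mu i != nu)) && (mu i == mu0)) m' i.
  apply: eq_big => [i|i /andP[_ /eqP muE]].
    by case: (P i) => //=; case: eqP => [->|_]; rewrite ?andbF // eq_sym ne_i0.
  by rewrite /m' muE mulfV // scale1r.
apply: IHN.
- rewrite ltnS in lt_N; apply: leq_trans lt_N; apply/proper_card/properP; split.
    by apply/subsetP => i; rewrite !inE => /andP[/andP[-> _] ->].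
  by exists i0; rewrite !inE ?Pi0 // eqxx.
- by move=> i; rewrite /m' linearZ /= Em !scalerA mulrC.
have -> : \sum_(i | P i && (mu i != nu)) m' i
    = (mu0 - nu)^-1 *: (E (\sum_(i | P i) m i) - nu *: \sum_(i | P i) m i).
  rewrite linear_sum /= scaler_sumr -sumrB scaler_sumr.
  rewrite [RHS](bigID (fun i => mu i == nu)) /=.
  rewrite [X in _ = X + _]big1 ?add0r => [|i /andP[_ /eqP muE]]; last first.
    by rewrite Em muE subrr scaler0.
  by apply: eq_bigr => i _; rewrite Em -scalerBl scalerA mulrC.
by rewrite memvZ // memvB ?memvZ // EK.
Qed.

Lemma span_codomP (k : fieldType) (V : vectType k) (T : finType)
    (F : T -> V) z :
  z \in <<codom F>>%VS -> exists s : T -> k, z = \sum_t s t *: F t.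
Proof.
rewrite span_def big_map big_enum /= => /memv_sumP[v vP ->].
have [s sP] := fin_all_exists (fun t => vlineP _ _ (vP t isT)).
by exists s; apply: eq_bigr => t _.
Qed.

Lemma prodv_span_sub (k : fieldType) (A : falgType k) (X Y : seq A)
    (W : {vspace A}) :
  (forall u v, u \in X -> v \in Y -> u * v \in W) -> (<<X>> * <<Y>> <= W)%VS.
Proof.
move=> XYW; apply/prodvP => u v uX vY.
suff /subvP/(_ _ uX) : (<<X>> <= amulr v @^-1: W)%VS.
  by rewrite -memv_preim lfunE.
apply/span_subvP => {uX}u uX; rewrite -memv_preim lfunE /=.
suff /subvP/(_ _ vY) : (<<Y>> <= amull u @^-1: W)%VS.
  by rewrite -memv_preim lfunE.
apply/span_subvP => {vY}v vY; rewrite -memv_preim lfunE /=.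
exact: XYW.
Qed.

(** * Reordering powers of [x] and [y], and the skew derivation in [x] *)

Section Lowering.
Variables (n : nat) (k : fieldType) (a1 a2 : ZZ n -> k) (c : k).
Variables (H : hopfAlgebra k) (gam : ZZ n -> H) (x y : H) (g g' : ZZ n).
Hypothesis n_ge2 : (2 <= n)%N.
Hypothesis char0 : [pchar k] =i pred0.
Hypothesis nz_c : c != 0.
Hypothesis a1_char : multiplicative_char a1.
Hypothesis presH : is_presented a1 a2 c gam x y.
Hypothesis comul_x : comul H x = tens x 1 + tens (gam g) x.
Hypothesis comul_y : comul H y = tens y 1 + tens (gam g') y.
Hypothesis comul_gam : forall f, comul H (gam f) = tens (gam f) (gam f).

Local Notation mono := (monomial gam x y).

Lemma commXx (b : nat) : y ^+ b * x = c^-1 ^+ b *: (x * y ^+ b).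
Proof.
have [[_ [_ _ xy _ _]] _] := presH.
have yx : y * x = c^-1 *: (x * y) by rewrite xy scalerA mulVf // scale1r.
elim: b => [|b IHb]; first by rewrite !expr0 scale1r mulr1 mul1r.
rewrite exprS -mulrA IHb -scalerAr [y * (x * _)]mulrA yx -scalerAl scalerA.
by rewrite -exprSr -mulrA.
Qed.

Lemma commXX (a b : nat) :
  y ^+ b * x ^+ a = c^-1 ^+ (a * b) *: (x ^+ a * y ^+ b).
Proof.
elim: a => [|a IHa]; first by rewrite mul0n !expr0 scale1r mulr1 mul1r.
rewrite exprS mulrA commXx -scalerAl -(mulrA x (y ^+ b)) IHa.
by rewrite -scalerAr scalerA (mulrA x) -exprD mulSn.
Qed.

(** Entry (1, 0) for the 2-by-2 block. The coefficients are nonzero for 0 < [a] < [n] because [a1 g]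
    is a primitive [n]-th root of unity. *)
Lemma lower_x : exists D t, [/\ coideal_stable D, t 0%N = 0,
    forall a, (0 < a < n)%N -> t a != 0
  & forall a b f, D (mono a b f) = t a *: mono a.-1 b f].
Proof.
have [D [DK DE]] :=
  divided_derivation a1_char presH comul_x comul_y comul_gam n_ge2.
exists (D 1), (fun a => (gauss_poly (a1 g) a)`_1); split.
- exact: DK.
- by rewrite gauss_poly_gt.
- move=> a; apply: gauss_poly1_neq0.
  exact: (prim_weight a1_char presH comul_x comul_y).
- by move=> a b f; rewrite DE subn1.
Qed.

End Lowering.

(** * Characters separating the elements of [G] *)

Section DotChars.
Variables (n : nat) (k : fieldType) (q : k).
Hypothesis n_ge2 : (2 <= n)%N.
Hypothesis prim_q : n.-primitive_root q.

Lemma prim_expZ (u v : 'Z_n) : q ^+ (u + v)%R = q ^+ u * q ^+ v.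
Proof.
by rewrite -exprD /= expr_mod // Zp_cast // (prim_expr_order prim_q).
Qed.

Lemma prim_expZ_inj : injective (fun u : 'Z_n => q ^+ u).
Proof.
move=> u v /eqP; rewrite (eq_prim_root_expr prim_q) => /eqP uv; apply: val_inj.
have ltn (w : 'Z_n) : (w < n)%N by rewrite -[X in (_ < X)%N](Zp_cast n_ge2).
by move: uv; rewrite !modn_small.
Qed.

Lemma dot1_char : multiplicative_char (@dot1 n k q).
Proof. by split=> // f f'; rewrite /dot1 prim_expZ. Qed.

Lemma dot2_char : multiplicative_char (@dot2 n k q).
Proof. by split=> // f f'; rewrite /dot2 prim_expZ. Qed.

Lemma dot12_inj (f f' : ZZ n) :
  (dot1 q f == dot1 q f') && (dot2 q f == dot2 q f') = (f == f').
Proof.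
by rewrite /dot1 /dot2 !(inj_eq prim_expZ_inj) -xpair_eqE -!surjective_pairing.
Qed.

End DotChars.

(** * Lowering, and combinations of monomials of one weight *)

Section Combinations.
Variables (n : nat) (k : fieldType) (q : k) (a1 a2 : ZZ n -> k) (c : k).
Variables (H : hopfAlgebra k) (gam : ZZ n -> H) (x y : H) (g g' : ZZ n).
Hypothesis n_ge2 : (2 <= n)%N.
Hypothesis char0 : [pchar k] =i pred0.
Hypothesis prim_q : n.-primitive_root q.
Hypothesis nz_c : c != 0.
Hypothesis a1_char : multiplicative_char a1.
Hypothesis a2_char : multiplicative_char a2.
Hypothesis presH : is_presented a1 a2 c gam x y.
Hypothesis comul_x : comul H x = tens x 1 + tens (gam g) x.
Hypothesis comul_y : comul H y = tens y 1 + tens (gam g') y.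
Hypothesis comul_gam : forall f, comul H (gam f) = tens (gam f) (gam f).

Local Notation mono := (monomial gam x y).

Lemma lower_y : exists D (t : nat -> nat -> k), [/\ coideal_stable D,
    forall a, t a 0%N = 0, forall a b, (0 < b < n)%N -> t a b != 0
  & forall a b f, D (mono a b f) = t a b *: mono a b.-1 f].
Proof.
have [D [t [DK t0 nz_t DE]]] := lower_x n_ge2 char0 a2_char
  (is_presented_swap nz_c presH) comul_y comul_x comul_gam.
have monoE a b f : monomial gam y x b a f = c^-1 ^+ (a * b) *: mono a b f.
  by rewrite /monomial (commXX nz_c presH) -scalerAl.
(* The powers of [c] come from reordering y^b x^a before the derivation and y^(b-1) x^a after it. *)
exists D, (fun a b => c ^+ (a * b) * t b * c^-1 ^+ (a * b.-1)); split => //.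
- by move=> a; rewrite t0 mulr0 mul0r.
- by move=> a b /nz_t tb; rewrite !mulf_neq0 ?expf_neq0 ?invr_eq0.
move=> a b f; have := DE b a f; rewrite !monoE linearZ /= => eqD.
rewrite -2!scalerA -eqD scalerA -exprMn mulfV // expr1n scale1r.
by [].
Qed.

(** Iterated skew derivations. A monomial with too small an exponent is killed, which makes the
    truncated subtractions harmless. *)
Lemma lower i j : exists D (t : nat -> nat -> k), [/\ coideal_stable D,
    forall a b, (a < i)%N || (b < j)%N -> t a b = 0,
    forall a b, (i <= a < n)%N -> (j <= b < n)%N -> t a b != 0
  & forall a b f, D (mono a b f) = t a b *: mono (a - i) (b - j) f].
Proof.
elim: i => [|i [D [t [DK t0 nz_t DE]]]].
  elim: j => [|j [D [t [DK t0 nz_t DE]]]].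
    exists \1%VF, (fun _ _ => 1); split=> //.
    - by move=> K _ z; rewrite id_lfunE.
    - by move=> *; rewrite oner_eq0.
    - by move=> a b f; rewrite id_lfunE scale1r !subn0.
  have [D1 [s [D1K s0 nz_s D1E]]] := lower_y.
  exists (D1 \o D)%VF, (fun a b => t a b * s a (b - j)%N); split.
  - by move=> K KP z zK; rewrite comp_lfunE D1K // DK.
  - move=> a b /=; rewrite ltnS leq_eqVlt => /predU1P[->|lt_bj].
      by rewrite subnn s0 mulr0.
    by rewrite t0 ?mul0r.
  - move=> a b lt_an /andP[lt_jb lt_bn].
    rewrite mulf_neq0 ?nz_t ?nz_s ?lt_bn ?(ltnW lt_jb) //.
    by rewrite subn_gt0 lt_jb (leq_ltn_trans (leq_subr _ _)).
  by move=> a b f; rewrite comp_lfunE DE linearZ /= D1E scalerA !subn0 subnS.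
have [D1 [s [D1K s0 nz_s D1E]]] :=
  lower_x n_ge2 char0 a1_char presH comul_x comul_y comul_gam.
exists (D1 \o D)%VF, (fun a b => t a b * s (a - i)%N); split.
- by move=> K KP z zK; rewrite comp_lfunE D1K // DK.
- move=> a b; rewrite ltnS leq_eqVlt -orbA => /predU1P[->|lt_ab].
    by rewrite subnn s0 mulr0.
  by rewrite t0 ?mul0r.
- move=> a b /andP[lt_ia lt_an] lt_b.
  rewrite mulf_neq0 ?nz_t ?nz_s ?lt_an ?(ltnW lt_ia) //.
  by rewrite subn_gt0 lt_ia (leq_ltn_trans (leq_subr _ _)).
by move=> a b f; rewrite comp_lfunE DE linearZ /= D1E scalerA subnS.
Qed.

Let gam0 : gam 0 = 1. Proof. by case: presH => [[[]]]. Qed.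
Let gamD f f' : gam (f + f') = gam f * gam f'.
Proof. by case: presH => [[[_ ->]]]. Qed.
Let gam_x f : gam f * x = a1 f *: x * gam f.
Proof. by case: presH => [[_ [_ _ _ ->]]]. Qed.
Let gam_y f : gam f * y = a2 f *: y * gam f.
Proof. by case: presH => [[_ [_ _ _ _ ->]]]. Qed.

Lemma mono_x a b f : mono a b f * x = (a1 f * c^-1 ^+ b) *: mono a.+1 b f.
Proof.
rewrite /monomial -mulrA gam_x -(mulrA (x ^+ a)) -!scalerAl -!scalerAr.
rewrite (mulrA (y ^+ b)) (commXx nz_c presH) -scalerAl -scalerAr.
by rewrite scalerA exprSr !mulrA.
Qed.

Lemma mono_y a b f : mono a b f * y = a2 f *: mono a b.+1 f.
Proof.
by rewrite /monomial -mulrA gam_y -!scalerAl -!scalerAr exprSr !mulrA.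
Qed.

Lemma mono_gam a b f f' : mono a b f * gam f' = mono a b (f + f').
Proof. by rewrite /monomial gamD mulrA. Qed.

Lemma mono_large a b f : ~~ ((a < n) && (b < n))%N -> mono a b f = 0.
Proof.
have [[_ [xn yn _ _ _]] _] := presH.
rewrite negb_and -!leqNgt /monomial => /orP[] /subnK <-.
  by rewrite exprD xn mulr0 !mul0r.
by rewrite exprD yn mulr0 mulr0 mul0r.
Qed.

(** Straightening: right multiplication by [x], [y] or [gam f] sends a monomial to a multiple of
    one. *)
Lemma taft_degree_sub d : (taft_degree gam x y d <=
  <<codom (fun p : 'I_d.+1 * ZZ n => mono p.1 (d - p.1) p.2)>>)%VS.
Proof.
pose X m := codom (fun p : 'I_m.+1 * ZZ n => mono p.1 (m - p.1) p.2).
have mem_X m a f : (a <= m)%N -> mono a (m - a) f \in <<X m>>%VS.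
  rewrite -ltnS => lt_am; apply: memv_span.
  by apply/codomP; exists (Ordinal lt_am, f).
rewrite /taft_degree -/(X d); elim: d => [|d IHd].
  rewrite expv0 prodv1; apply/span_subvP => _ /codomP[f ->].
  by have := mem_X 0 0 f isT; rewrite /monomial !expr0 !mul1r.
rewrite expvSr prodvA; apply: subv_trans (prodvSl _ IHd) _.
rewrite prodvA; apply: (@subv_trans _ _ (<<X d.+1>> * <<codom gam>>)%VS).
  apply/prodvSl/prodv_span_sub => _ v /codomP[[a f] ->]; rewrite !inE /=.
  have le_ad : (a <= d)%N by rewrite -ltnS.
  case/orP => /eqP ->.
    by rewrite mono_x memvZ // -subSS mem_X.
  by rewrite mono_y memvZ // -subSn // mem_X // leqW.
apply: prodv_span_sub => _ _ /codomP[[a f] ->] /codomP[f' ->].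
by rewrite mono_gam mem_X // -ltnS.
Qed.

(** The group elements are chosen so that the weight a g + (d - a) g' + f of x^a y^(d-a) f is d g +
    f0 for every [a]; in the application [g - g'] is (1, 1). *)
Definition comb d f0 (C : nat -> k) : H :=
  \sum_(a < d.+1) C a *: mono a (d - a) (f0 + (g - g') *+ (d - a)).

Lemma weight_comb K d z : left_coideal_subalgebra K -> z \in K ->
  z \in taft_degree gam x y d ->
  exists C : ZZ n -> nat -> k,
    z = \sum_u comb d u (C u) /\ forall u, comb d u (C u) \in K.
Proof.
move=> KP zK /(subvP (taft_degree_sub d))/span_codomP[s zE].
pose phi u a : ZZ n := u + (g - g') *+ (d - a).
exists (fun u a => s (inord a, phi u a)); split=> [|u].
  rewrite zE /comb exchange_big /=.
  transitivity (\sum_(a < d.+1) \sum_f s (a, f) *: mono a (d - a) f).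
    by rewrite pair_bigA; apply: eq_bigr => -[].
  apply: eq_bigr => a _; rewrite (reindex_inj (addIr ((g - g') *+ (d - a)))) /=.
  by apply: eq_bigr => f _; rewrite inord_val.
have [E1 [E1K E1E]] := eigen_operator a1_char presH comul_x comul_y comul_gam
  (ltnW n_ge2) (dot1_char n_ge2 prim_q).
have [E2 [E2K E2E]] := eigen_operator a1_char presH comul_x comul_y comul_gam
  (ltnW n_ge2) (dot2_char n_ge2 prim_q).
pose I := ('I_d.+1 * ZZ n)%type.
pose m (p : I) := s p *: mono p.1 (d - p.1) p.2.
pose w (p : I) : ZZ n := g *+ p.1 + g' *+ (d - p.1) + p.2.
have E1m p : E1 (m p) = dot1 q (w p) *: m p.
  by rewrite /m linearZ /= E1E !scalerA mulrC.
have E2m p : E2 (m p) = dot2 q (w p) *: m p.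
  by rewrite /m linearZ /= E2E !scalerA mulrC.
rewrite zE in zK.
(* The [dot1] and then the [dot2] eigencomponent at d g + u leave exactly the monomials of that
   weight. *)
have := eigen_component (E2K K KP) E2m (eigen_component (E1K K KP) E1m zK
  (dot1 q (g *+ d + u))) (dot2 q (g *+ d + u)).
rewrite (eq_bigl (fun p : I => p.2 == phi u p.1)) => [|p]; last first.
  rewrite /= (dot12_inj n_ge2 prim_q) /w /phi.
  have le_pd : (p.1 <= d)%N by rewrite -ltnS.
  have -> : g *+ d = g *+ p.1 + g *+ (d - p.1) by rewrite -mulrnDr subnKC.
  have -> : g *+ p.1 + g *+ (d - p.1) + u =
    (g *+ p.1 + g' *+ (d - p.1)) + (u + (g - g') *+ (d - p.1)).
    rewrite mulrnBl -!addrA; congr (_ + _).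
    by rewrite [RHS]addrC -!addrA addNr addr0 addrC.
  by rewrite (inj_eq (addrI _)).
suff -> : comb d u (fun a => s (inord a, phi u a)) =
  \sum_(p : I | p.2 == phi u p.1) m p by [].
transitivity (\sum_(a < d.+1) \sum_(f : ZZ n | f == phi u a) m (a, f)).
  by apply: eq_bigr => a _; rewrite big_pred1_eq /m /= inord_val.
by rewrite pair_big_dep; apply: eq_bigr => -[].
Qed.

(** [lower] has coefficients known to be nonzero only for exponents below [n]; the other monomials
    are 0, so their coefficients can be reset to 0. *)
Definition in_range d (C : nat -> k) :=
  forall a, (a <= d)%N -> C a != 0 -> ((a < n) && (d - a < n))%N.

Lemma comb_in_range d f0 C : exists2 C', in_range d C' &
  comb d f0 C = comb d f0 C' /\ (C d = 0 -> C' d = 0).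
Proof.
exists (fun a => if ((a < n) && (d - a < n))%N then C a else 0).
  by move=> a _; case: ifP => // _; rewrite eqxx.
split=> [|->]; last by case: ifP.
apply: eq_bigr => a _; case: ifPn => // out.
by rewrite mono_large // !scaler0.
Qed.

(** * Lowering inside a left coideal subalgebra [K] *)

Section CoidealSubalgebra.
Variable K : {vspace H}.
Hypothesis KP : left_coideal_subalgebra K.

Lemma coidealM u v : u \in K -> v \in K -> u * v \in K.
Proof. by case: KP => _ /prodvP KM _; apply: KM. Qed.

Lemma coidealX u m : u \in K -> u ^+ m \in K.
Proof.
move=> uK; elim: m => [|m IHm]; first by rewrite expr0; case: KP.
by rewrite exprS coidealM.
Qed.

Lemma coideal_gamN f : gam f \in K -> gam (- f) \in K.
Proof.
move=> fK; have <- : f *+ n.-1 = - f.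
  apply/eqP; rewrite -addr_eq0 -mulrSr (ltn_predK n_ge2); apply/eqP.
  exact: ZZ_mulrn n_ge2.
elim: n.-1 => [|m IHm]; first by rewrite mulr0n gam0; case: KP.
by rewrite mulrS gamD coidealM.
Qed.

Lemma gam_divr u f : u * gam f \in K -> gam f \in K -> u \in K.
Proof.
move=> uK /coideal_gamN fK; have := coidealM uK fK.
by rewrite -mulrA -gamD subrr gam0 mulr1.
Qed.

(** Lower by (a, d - a): in total degree [d] any other term has too small an exponent of [x] or of
    [y] and dies, while term [a] leaves a nonzero multiple of its group element. *)
Lemma term_gam d f0 C a : in_range d C -> comb d f0 C \in K ->
  (a <= d)%N -> C a != 0 -> gam (f0 + (g - g') *+ (d - a)) \in K.
Proof.
move=> CP CK le_ad nz_Ca; have /andP[lt_an lt_bn] := CP a le_ad nz_Ca.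
have [D [t [DK t0 nz_t DE]]] := lower a (d - a).
have lt_ad : (a < d.+1)%N by [].
have := DK K KP _ CK; rewrite /comb linear_sum (bigD1 (Ordinal lt_ad)) //=.
rewrite big1 ?addr0 => [|i]; last first.
  rewrite -val_eqE /= neq_ltn => ne_ia.
  rewrite linearZ /= DE t0 ?scale0r ?scaler0 //.
  case/orP: ne_ia => [->//|lt_ai].
  by rewrite ltn_sub2l ?orbT // (leq_trans lt_ai) // -ltnS.
rewrite linearZ /= DE !subnn /monomial !expr0 !mul1r scalerA => inK.
have nz : C a * t a (d - a)%N != 0 by rewrite mulf_neq0 // nz_t ?leqnn.
by have := memvZ (C a * t a (d - a)%N)^-1 inK; rewrite scalerA mulVf // scale1r.
Qed.

(** Lowering by (a, d - a) in degree d + 1 leaves only the indices [a.+1] and [a]. The scalars are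
    known to be nonzero where the exponents are in range, hence the guards. *)
Lemma two_term d f0 C a :
  in_range d.+1 C -> comb d.+1 f0 C \in K -> (a <= d)%N ->
  exists s t, [/\ C a.+1 != 0 -> s != 0, C a != 0 -> t != 0 &
    (C a.+1 * s) *: (x * gam (f0 + (g - g') *+ (d - a)))
    + (C a * t) *: (y * gam (f0 + (g - g') *+ (d - a).+1)) \in K].
Proof.
move=> CP CK le_ad.
have [D [t [DK t0 nz_t DE]]] := lower a (d - a).
exists (t a.+1 (d - a)%N), (t a (d - a).+1); split.
- move=> /(CP a.+1 le_ad)/andP[lt_an]; rewrite subSS => lt_bn.
  by rewrite nz_t ?leqnn ?leqnSn.
- move=> /(CP a (leqW le_ad))/andP[lt_an]; rewrite subSn // => lt_bn.
  by rewrite nz_t ?leqnn ?leqnSn.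
have lt_ad1 : (a.+1 < d.+2)%N by rewrite ltnS.
have lt_ad : (a < d.+2)%N by apply: ltnW.
have := DK K KP _ CK; rewrite /comb linear_sum (bigD1 (Ordinal lt_ad1)) //=.
rewrite (bigD1 (Ordinal lt_ad)) /=; last by rewrite -val_eqE /= ltn_eqF.
rewrite big1 ?addr0 => [|i]; last first.
  rewrite -!val_eqE /= => /andP[ne_ia1 ne_ia].
  rewrite linearZ /= DE t0 ?scale0r ?scaler0 //.
  have [//|le_ai] := ltnP i a; have lt_ai : (a.+1 < i)%N.
    by rewrite ltn_neqAle eq_sym ne_ia1 ltn_neqAle eq_sym ne_ia.
  by rewrite /= -[(d - a)%N]subSS ltn_sub2l // (leq_trans lt_ai) // -ltnS.
rewrite !linearZ /= !DE !scalerA subSS (subSn le_ad) !subSnn !subnn /monomial.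
by rewrite !expr0 !expr1 mulr1 mul1r.
Qed.

(** The [y] part of [two_term] is 0 or a multiple of a product of elements of [K]; subtract it and
    cancel the group element of the [x] part. *)
Lemma x_mem_coideal d f0 C a : in_range d.+1 C -> comb d.+1 f0 C \in K ->
  (a <= d)%N -> C a.+1 != 0 -> (C a != 0 -> y \in K) -> x \in K.
Proof.
move=> CP CK le_ad nz_Ca1 yK; have [s [t [nz_s _]]] := two_term CP CK le_ad.
rewrite rpredDr => [|]; last first.
  have [->|nz_Ca] := eqVneq (C a) 0; first by rewrite mul0r scale0r mem0v.
  rewrite memvZ ?coidealM ?yK // -subSn //.
  exact: term_gam CP CK (leqW le_ad) nz_Ca.
rewrite rpredZeq mulf_eq0 (negbTE nz_Ca1) (negbTE (nz_s nz_Ca1)) /= => xK.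
by apply: gam_divr xK _; rewrite -subSS; apply: term_gam CP CK _ nz_Ca1.
Qed.

Lemma y_mem_coideal d f0 C a : in_range d.+1 C -> comb d.+1 f0 C \in K ->
  (a <= d)%N -> C a != 0 -> (C a.+1 != 0 -> x \in K) -> y \in K.
Proof.
move=> CP CK le_ad nz_Ca xK; have [s [t [_ nz_t]]] := two_term CP CK le_ad.
rewrite rpredDl => [|]; last first.
  have [->|nz_Ca1] := eqVneq (C a.+1) 0; first by rewrite mul0r scale0r mem0v.
  rewrite memvZ ?coidealM ?xK // -subSS.
  exact: term_gam CP CK _ nz_Ca1.
rewrite rpredZeq mulf_eq0 (negbTE nz_Ca) (negbTE (nz_t nz_Ca)) /= => yK.
apply: gam_divr yK _; rewrite -subSn //.
exact: term_gam CP CK (leqW le_ad) nz_Ca.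
Qed.

Lemma linear_mem_coideal r s : r *: x + s *: (y * gam (g - g')) \in K ->
  [/\ s != 0 -> gam (g - g') \in K, x \notin K -> r != 0 -> s != 0
    & y \notin K -> s != 0 -> r != 0].
Proof.
(* The index is the exponent of [x], so the [y] term has index 0. *)
pose C a := if a is 0%N then s else r.
have -> : r *: x + s *: (y * gam (g - g')) = comb 1 0 C.
  rewrite /comb big_ord_recl big_ord1 /= addrC /monomial.
  by rewrite mulr0n mulr1n addr0 add0r gam0 !expr0 !expr1 !mulr1 !mul1r.
have CP : in_range 1 C by case=> [|[]] //= _ _; rewrite n_ge2 ltnW.
move=> CK; split=> [nz_s|xK nz_r|yK nz_s].
- by have := term_gam CP CK (leq0n 1) nz_s; rewrite add0r mulr1n.
- apply: contraNneq xK => s0; apply: x_mem_coideal CP CK (leqnn 0) nz_r _.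
  by rewrite /= s0 eqxx.
apply: contraNneq yK => r0; apply: y_mem_coideal CP CK (leqnn 0) nz_s _.
by rewrite /= r0 eqxx.
Qed.

(** Descending induction: a nonzero coefficient just below a zero one would put [y] in [K], by
    [y_mem_coideal]. *)
Lemma comb_eq0 d f0 C : x \notin K -> y \notin K -> comb d f0 C \in K ->
  C d = 0 -> comb d f0 C = 0.
Proof.
move=> xK yK; have [C' CP [-> Cd]] := comb_in_range d f0 C.
move: C' CP Cd => {}C' CP Cd CK /Cd Cd0.
suff C0 m : (m <= d)%N -> C' (d - m)%N = 0.
  rewrite /comb big1 // => a _; have le_ad : (a <= d)%N by rewrite -ltnS.
  by rewrite -(subKn le_ad) C0 ?leq_subr // scale0r.
elim: m => [|m IHm] lt_md; first by rewrite subn0.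
apply: contraNeq yK => nz_C.
case: d CP CK {Cd Cd0} IHm lt_md nz_C => // d CP CK IHm.
rewrite ltnS => le_md; rewrite subSS => nz_C.
apply: y_mem_coideal CP CK (leq_subr m d) nz_C _.
by rewrite -subSn // IHm ?eqxx // leqW.
Qed.

Lemma comb_mul_linear d C (r s : k) : exists2 C',
  comb d 0 C * (r *: x + s *: (y * gam (g - g'))) = comb d.+1 0 C'
  & C' d.+1 = r * C d.
Proof.
(* [C1] comes from the [x] summand, which raises the index, and [C2] from the other. The top index
   receives only x^d times [x], without commutation factor. *)
pose C1 a := if a is a'.+1 then
  r * C a' * (a1 ((g - g') *+ (d - a')) * c^-1 ^+ (d - a')) else 0.
pose C2 a := if (a <= d)%N then s * C a * a2 ((g - g') *+ (d - a)) else 0.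
exists (fun a => C1 a + C2 a); last first.
  by rewrite /C1 /C2 ltnn addr0 subnn mulr0n a1_char.1 expr0 !mulr1.
rewrite /comb; under [RHS]eq_bigr do rewrite scalerDl.
rewrite big_split /= mulrDr; congr (_ + _).
  rewrite [RHS]big_ord_recl /= scale0r add0r mulr_suml; apply: eq_bigr => a _.
  rewrite /bump leq0n add1n subSS -scalerAr -scalerAl mono_x !scalerA.
  by rewrite add0r !add0n.
rewrite [RHS]big_ord_recr /= /C2 ltnn scale0r addr0 mulr_suml.
apply: eq_bigr => a _; have le_ad : (a <= d)%N by rewrite -ltnS.
rewrite le_ad subSn // -scalerAr -scalerAl mulrA mono_y -scalerAl mono_gam.
by rewrite !scalerA !add0r -mulrSr !mulrA.
Qed.

Lemma linear_exp_comb m (r s : k) : exists2 C,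
  (r *: x + s *: (y * gam (g - g'))) ^+ m = comb m 0 C & C m = r ^+ m.
Proof.
elim: m => [|m [C CE Cm]].
  exists (fun _ => 1) => //; rewrite /comb big_ord1 /= scale1r.
  by rewrite /monomial subnn mulr0n addr0 gam0 !expr0 !mulr1.
have [C' C'E C'm] := comb_mul_linear m C r s.
by exists C'; [rewrite exprSr CE C'E | rewrite C'm Cm exprS].
Qed.

Lemma comb_gam d C f0 : comb d 0 C * gam f0 = comb d f0 C.
Proof.
rewrite /comb mulr_suml; apply: eq_bigr => a _.
by rewrite -scalerAl mono_gam add0r addrC.
Qed.

(** * Membership in a subalgebra [A] containing the group elements of [K] *)

Variable A : {vspace H}.
Hypothesis A1 : 1 \in A.
Hypothesis AM : forall u v, u \in A -> v \in A -> u * v \in A.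
Hypothesis Agam : forall f, gam f \in K -> gam f \in A.

Let AX u m : u \in A -> u ^+ m \in A.
Proof. by move=> uA; elim: m => [|m IHm]; rewrite ?expr0 // exprS AM. Qed.

(** Term by term: the group element is in [K] by [term_gam], and if one of [x], [y] is in [K], so is
    the other once it occurs with a nonzero coefficient. *)
Lemma comb_mem_xy d f0 C : (x \in K -> x \in A) -> (y \in K -> y \in A) ->
  (x \in K) || (y \in K) -> comb d f0 C \in K -> comb d f0 C \in A.
Proof.
move=> Ax Ay xyK; have [C' CP [-> _]] := comb_in_range d f0 C.
move: C' CP => {}C CP CK; apply: memv_suml => a _.
have [->|nz_Ca] := eqVneq (C a) 0; first by rewrite scale0r mem0v.
have le_ad : (a <= d)%N by rewrite -ltnS.
rewrite memvZ // AM ?Agam //; last exact: term_gam CP CK le_ad nz_Ca.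
case: a le_ad nz_Ca => /= a _ le_ad nz_Ca; apply: AM.
  have [->|a_gt0] := posnP a; first by rewrite expr0.
  apply/AX/Ax; case: orP xyK => // -[//|yK] _.
  case: d CP CK le_ad => [|d] CP CK; case: a nz_Ca a_gt0 => // a nz_Ca _ le_ad.
  exact: x_mem_coideal CP CK le_ad nz_Ca _.
have [->|] := posnP (d - a); first by rewrite expr0.
rewrite subn_gt0 => lt_ad; apply/AX/Ay; case: orP xyK => // -[xK|//] _.
case: d CP CK le_ad lt_ad => // d CP CK _ lt_ad.
exact: y_mem_coideal CP CK lt_ad nz_Ca _.
Qed.

Lemma comb_mem_mixed d f0 C : x \notin K -> y \notin K ->
  (forall r s, r *: x + s *: (y * gam (g - g')) \in K ->
     r *: x + s *: (y * gam (g - g')) \in A) ->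
  comb d f0 C \in K -> comb d f0 C \in A.
Proof.
move=> xK yK Aw; have [C' CP [-> _]] := comb_in_range d f0 C.
move: C' CP => {}C CP CK.
have [Cd0|nz_Cd] := eqVneq (C d) 0; first by rewrite comb_eq0 ?mem0v.
have f0K : gam f0 \in K.
  by have := term_gam CP CK (leqnn d) nz_Cd; rewrite subnn mulr0n addr0.
case: d => [|d] in CP CK nz_Cd *.
  rewrite /comb big_ord1 subnn mulr0n addr0 /monomial !expr0 !mul1r.
  by rewrite memvZ ?Agam.
have nz_C : C d != 0.
  apply: contraNneq xK => Cd0; apply: x_mem_coideal CP CK (leqnn d) nz_Cd _.
  by rewrite Cd0 eqxx.
have [s [t [nz_s _]]] := two_term CP CK (leqnn d).
(* [gam f0] is moved to the right and cancelled, which leaves a combination of [x] and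
   [y * gam (g - g')] in [K]. *)
rewrite subnn mulr0n addr0 mulr1n (addrC f0) gamD (mulrA y).
rewrite !scalerAl -mulrDl => /gam_divr/(_ f0K).
set r := C d.+1 * s; set r' := C d * t => wK; rewrite -scalerAl in wK.
have nz_r : r != 0 by rewrite mulf_neq0 ?nz_s.
have [C1 C1E C1d] := linear_exp_comb d.+1 r r'.
(* [e] matches the top coefficients; the difference has top coefficient 0 and vanishes by
   [comb_eq0]. *)
pose e := C d.+1 / r ^+ d.+1.
have combB : comb d.+1 f0 C - e *: comb d.+1 f0 C1
    = comb d.+1 f0 (fun a => C a - e * C1 a).
  rewrite /comb scaler_sumr -sumrB; apply: eq_bigr => a _.
  by rewrite scalerA -scalerBl.
have wXK : comb d.+1 f0 C1 \in K.
  by rewrite -comb_gam -C1E coidealM ?coidealX.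
rewrite -[comb d.+1 f0 C](subrK (e *: comb d.+1 f0 C1)) combB comb_eq0 //.
- by rewrite add0r memvZ // -comb_gam -C1E AM ?Agam // AX // Aw.
- by rewrite -combB memvB ?memvZ.
by rewrite C1d /e divfK ?subrr // expf_neq0.
Qed.

End CoidealSubalgebra.

End Combinations.

(** * Coordinates on V_1 and V_2 *)

Lemma mem_V1 (k : fieldType) (w : VV k) : (w \in V1 k) = (w.2 == 0).
Proof.
apply/vlineP/eqP => [[s ->]|]; first by rewrite /= scaler0.
case: w => s t /= ->; exists s; congr (_, _); rewrite ?scaler0 //.
by rewrite /GRing.scale /= mulr1.
Qed.

Lemma mem_V2 (k : fieldType) (w : VV k) : (w \in V2 k) = (w.1 == 0).
Proof.
apply/vlineP/eqP => [[s ->]|]; first by rewrite /= scaler0.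
case: w => s t /= ->; exists t; congr (_, _); rewrite ?scaler0 //.
by rewrite /GRing.scale /= mulr1.
Qed.

Lemma capV12 (k : fieldType) : (V1 k :&: V2 k = 0)%VS.
Proof.
apply/eqP; rewrite -subv0; apply/subvP => -[s t].
rewrite memv_cap mem_V1 mem_V2 /=.
by case/andP => /eqP -> /eqP ->; rewrite memv0.
Qed.

(** * The datum of a homogeneous left coideal subalgebra *)

Section Datum.
Variables (n : nat) (k : fieldType) (q : k) (a1 a2 : ZZ n -> k) (c : k).
Variables (H : hopfAlgebra k) (gam : ZZ n -> H) (x y : H).
Hypothesis n_ge2 : (2 <= n)%N.
Hypothesis char0 : [pchar k] =i pred0.
Hypothesis prim_q : n.-primitive_root q.
Hypothesis nz_c : c != 0.
Hypothesis a1_char : multiplicative_char a1.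
Hypothesis a2_char : multiplicative_char a2.
Hypothesis hopfH : is_hopf_presented a1 a2 c gam x y.
Variable K : {vspace H}.
Hypothesis KP : left_coideal_subalgebra K.
Hypothesis homK : homogeneous (taft_degree gam x y) (taft_top n) K.

Let presH : is_presented a1 a2 c gam x y. Proof. by case: hopfH. Qed.
Let comul_x : comul H x = tens x 1 + tens (gam (1, 0)) x.
Proof. by case: hopfH. Qed.
Let comul_y : comul H y = tens y 1 + tens (gam (0, -1)) y.
Proof. by case: hopfH. Qed.
Let comul_gam f : comul H (gam f) = tens (gam f) (gam f).
Proof. by case: hopfH. Qed.
Let gam0 : gam 0 = 1. Proof. by case: presH => [[[]]]. Qed.
Let gamD f f' : gam (f + f') = gam f * gam f'.
Proof. by case: presH => [[[_ ->]]]. Qed.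
Let gam_x f : gam f * x = a1 f *: x * gam f.
Proof. by case: presH => [[_ [_ _ _ ->]]]. Qed.
Let gam_y f : gam f * y = a2 f *: y * gam f.
Proof. by case: presH => [[_ [_ _ _ _ ->]]]. Qed.

Let subg : (1, 0) - (0, -1) = (1, 1) :> ZZ n.
Proof. by congr (_, _); rewrite ?subr0 // sub0r opprK. Qed.

Lemma bracketE w : bracket gam x y w = w.1 *: x + w.2 *: (y * gam (1, 1)).
Proof. by rewrite lfunE. Qed.

Lemma bracket_mem w : bracket gam x y w \in K ->
  [/\ w.2 != 0 -> gam (1, 1) \in K, x \notin K -> w.1 != 0 -> w.2 != 0
    & y \notin K -> w.2 != 0 -> w.1 != 0].
Proof.
rewrite bracketE -subg.
exact: (linear_mem_coideal n_ge2 char0 nz_c a1_char a2_char presH comul_x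
  comul_y).
Qed.

Lemma stabilizer_group_set : group_set [set f | gam f \in K].
Proof.
apply/group_setP; split=> [|f f']; first by rewrite inE gam0; case: KP.
by rewrite !inE => fK f'K; rewrite gamD (coidealM KP).
Qed.

(** V_1 and V_2 are lines, so [W1] and [W2] are all or nothing. Once [x] or [y] is in [K], an
    element r x + s y h of [K], with h = (g, g), has both terms in [K], and no mixed part is left
    for [W3]. *)
Let F := Group stabilizer_group_set.
Let W1 := if x \in K then V1 k else 0%VS.
Let W2 := if y \in K then V2 k else 0%VS.
Let W3 := if (x \in K) || (y \in K) then 0%VS else (bracket gam x y @^-1: K)%VS.

Let memF f : (f \in F) = (gam f \in K). Proof. by rewrite inE. Qed.

(** If one coordinate of [w] were 0, its bracket would put [x] or [y] in [K]. *)
Lemma W3_cases w : w \in W3 -> w != 0 ->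
  [/\ x \notin K, y \notin K & [/\ bracket gam x y w \in K, gam (1, 1) \in K,
      w.1 != 0 & w.2 != 0]].
Proof.
rewrite /W3; case: ifPn => [_|]; first by rewrite memv0 => ->.
rewrite negb_or => /andP[xK yK]; rewrite -memv_preim => wK nz_w.
have [hK r_s s_r] := bracket_mem wK.
have nz2 : w.2 != 0.
  apply: contraNneq nz_w => w20; have [|nz1] := eqVneq w.1 0.
    by case: (w) w20 => /= s t -> ->.
  by have := r_s xK nz1; rewrite w20 eqxx.
by split=> //; split=> //; [apply: hK | apply: s_r].
Qed.

Lemma homogeneous_datum : coideal_datum a1 a2 W1 W2 W3 F.
Proof.
have W3V1 : (W3 :&: V1 k = 0)%VS.
  apply/eqP; rewrite -subv0; apply/subvP => w /memv_capP[wW]; rewrite mem_V1.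
  by rewrite memv0; apply: contraTT => /(W3_cases wW)[_ _ []].
have W3V2 : (W3 :&: V2 k = 0)%VS.
  apply/eqP; rewrite -subv0; apply/subvP => w /memv_capP[wW]; rewrite mem_V2.
  by rewrite memv0; apply: contraTT => /(W3_cases wW)[_ _ []].
have W312 : (W3 :&: (W1 + W2) = 0)%VS.
  rewrite /W3 /W1 /W2; case: ifPn => [_|]; first by rewrite cap0v.
  by rewrite negb_or => /andP[/negbTE-> /negbTE->]; rewrite addv0 capv0.
have W12 : (W1 :&: W2 = 0)%VS.
  apply/eqP; rewrite -subv0 -(capV12 k) capvS // /W1 /W2.
    by case: ifP; rewrite ?subvv ?sub0v.
  by case: ifP; rewrite ?subvv ?sub0v.
split=> //.
- rewrite !directv_addE !directv_trivial /= W12 eqxx /=.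
  by rewrite capvC W312.
- move: W3V1; rewrite /W1 /W2 /W3; case: (x \in K); case: (y \in K) => /= capE.
  + by rewrite addv0; apply/capv_idPr/addvSl.
  + by rewrite !addv0 capvv.
  + by rewrite add0v addv0 capvC capV12.
  + by rewrite !add0v.
- move: W3V2; rewrite /W1 /W2 /W3; case: (x \in K); case: (y \in K) => /= capE.
  + by rewrite addv0; apply/capv_idPr/addvSr.
  + by rewrite !addv0 capV12.
  + by rewrite add0v addv0 capvv.
  + by rewrite !add0v.
- move=> f w _; rewrite /W1; case: ifP => _.
    by rewrite !mem_V1 /= => /eqP ->; rewrite scaler0.
  by rewrite !memv0 => /eqP ->; rewrite /diag_act /= !scaler0.
- move=> f w _; rewrite /W2; case: ifP => _.
    by rewrite !mem_V2 /= => /eqP ->; rewrite scaler0.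
  by rewrite !memv0 => /eqP ->; rewrite /diag_act /= !scaler0.
- move=> f w; rewrite memF => fK; rewrite /W3; case: ifP => _.
    by rewrite !memv0 => /eqP ->; rewrite /diag_act /= !scaler0.
  rewrite -!memv_preim => wK.
  (* [gam (1, 1)] commutes with [gam f], so conjugation by [gam f] acts on brackets through the
     weights. *)
  have -> : bracket gam x y (diag_act a1 a2 f w)
      = gam f * bracket gam x y w * gam (- f).
    rewrite !bracketE /diag_act /= mulrDr mulrDl; congr (_ + _).
      rewrite -scalerAr -scalerAl gam_x -mulrA -gamD subrr gam0 mulr1 scalerA.
      by rewrite mulrC.
    rewrite -scalerAr mulrA gam_y -!scalerAl -!mulrA -!gamD scalerA.
    by rewrite addrCA subrr addr0 mulrC.
  by rewrite !(coidealM KP) //; apply: (coideal_gamN n_ge2 presH KP).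
move=> nz_W3; rewrite memF; have nz_w : vpick W3 != 0 by rewrite vpick0.
by have [_ _ []] := W3_cases (memv_pick W3) nz_w.
Qed.

Lemma datum_algebra_sub : (datum_algebra gam x y W1 W2 W3 F <= K)%VS.
Proof.
have [K1 KK _] := KP.
apply: agenv_sub_modl; first by rewrite -memvE.
apply: subv_trans KK; apply: prodvSl; rewrite !subv_add -!andbA limgD subv_add.
apply/and3P; split.
- apply/span_subvP => u /imageP[f fF ->].
  by rewrite -memF.
- apply/andP; split; apply/subvP => _ /memv_imgP[w wW ->]; move: wW;
    rewrite lfunE /= /lin2.
    rewrite /W1; case: ifP => xK; rewrite ?memv0 ?mem_V1 => /eqP w0.
      by rewrite w0 scale0r addr0 memvZ.
    by rewrite w0 !scale0r addr0 mem0v.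
  rewrite /W2; case: ifP => yK; rewrite ?memv0 ?mem_V2 => /eqP w0.
    by rewrite w0 scale0r add0r memvZ.
  by rewrite w0 !scale0r addr0 mem0v.
apply/andP; split; apply/subvP => _ /memv_imgP[w wW ->].
  have [->|/(W3_cases wW)[_ _ []]//] := eqVneq w 0.
  by rewrite linear0 mem0v.
have [->|/(W3_cases wW)[_ _ [wK hK _ _]]] := eqVneq w 0.
  by rewrite linear0 mem0v.
(* The two brackets differ by a group element that is in [K] as soon as [W3] has a nonzero
   vector. *)
have -> : bracket_tilde gam x y w = bracket gam x y w * gam (- (1, 1)).
  rewrite bracketE lfunE /= /lin2 mulrDl -!scalerAl; congr (_ + _ *: _).
  by rewrite -mulrA -gamD subrr gam0 mulr1.
by rewrite (coidealM KP) //; apply: (coideal_gamN n_ge2 presH KP).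
Qed.

Lemma sub_datum_algebra : (K <= datum_algebra gam x y W1 W2 W3 F)%VS.
Proof.
set A := datum_algebra gam x y W1 W2 W3 F.
have A1 : 1 \in A by rewrite memvE sub1_agenv.
have AM u v : u \in A -> v \in A -> u * v \in A.
  by move=> uA vA; rewrite /A /datum_algebra -agenvM memv_mul.
have genA (U : {vspace H}) u : u \in U ->
    (U <= <<[seq gam f | f in F]>> + (linfun (lin2 x y) @: (W1 + W2))
         + (bracket gam x y @: W3) + (bracket_tilde gam x y @: W3))%VS ->
    u \in A.
  by move=> uU UG; apply: (subvP (sub_agenv _)); apply: (subvP UG).
have Agam f : gam f \in K -> gam f \in A.
  move=> fK; apply: (genA <<[seq gam f | f in F]>>%VS).
    by apply/memv_span/map_f; rewrite mem_enum memF.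
  by rewrite -!addvA addvSl.
have linA w : w \in (W1 + W2)%VS -> w.1 *: x + w.2 *: y \in A.
  move=> wW; apply: (genA (linfun (lin2 x y) @: (W1 + W2))%VS).
    by rewrite -[_ + _]/(lin2 x y w) -(lfunE (lin2 x y)) memv_img.
  by rewrite -addvA (subv_trans _ (addvSl _ _)) // addvSr.
have [Kd [KdH _ _ KE]] := homK.
apply/subvP => z; rewrite {1}KE => /memv_sumP[v vK ->].
apply: memv_suml => d _; have vd := vK d isT.
have vdK : v d \in K by rewrite KE; apply: (subvP (sumv_sup d isT (subvv _))).
(* Homogeneity has reduced to one degree; the weight decomposition reduces further to a single
   [comb]. *)
have [C [-> CK]] := weight_comb n_ge2 prim_q nz_c a1_char presH comul_x comul_y
  comul_gam KP vdK (subvP (KdH d) _ vd).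
apply: memv_suml => u _.
have [xyK|] := boolP ((x \in K) || (y \in K)).
  apply: (comb_mem_xy n_ge2 char0 nz_c a1_char a2_char presH comul_x comul_y
    comul_gam KP A1 AM Agam _ _ xyK (CK u)) => inK.
    have := linA (1, 0); rewrite /= scale1r scale0r addr0; apply.
    by apply: (subvP (addvSl _ _)); rewrite /W1 inK mem_V1.
  have := linA (0, 1); rewrite /= scale1r scale0r add0r; apply.
  by apply: (subvP (addvSr _ _)); rewrite /W2 inK mem_V2.
move=> nK; have := nK; rewrite negb_or => /andP[xK yK].
apply: (comb_mem_mixed n_ge2 char0 nz_c a1_char a2_char presH comul_x comul_y
  comul_gam KP A1 AM Agam xK yK _ (CK u)) => r s.
(* Such a degree-one element of [K] is the bracket of (r, s), which is in [W3] by its choice as a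
   preimage. *)
rewrite subg => wK; have wE := bracketE (r, s); rewrite -wE in wK *.
apply: (genA (bracket gam x y @: W3)%VS).
  by rewrite memv_img // /W3 (negbTE nK) -memv_preim.
by rewrite (subv_trans _ (addvSl _ _)) // addvSr.
Qed.

Lemma homogeneous_coideal_datum :
  exists (W1 W2 W3 : {vspace VV k}) (F : {group ZZ n}),
    coideal_datum a1 a2 W1 W2 W3 F /\ K = datum_algebra gam x y W1 W2 W3 F.
Proof.
exists W1, W2, W3, F; split; first exact: homogeneous_datum.
by apply/eqP; rewrite eqEsubv sub_datum_algebra datum_algebra_sub.
Qed.

End Datum.

(** * Both algebras as instances of one presentation *)

Unset Implicit Arguments.

Theorem theorem5p8 (k : closedFieldType) (chark : [pchar k] =i pred0)
    (n : nat) (n_ge2 : (2 <= n)%N) (q : k) (prim_q : n.-primitive_root q)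
    (chi1 chi2 : 'Z_n * 'Z_n -> k)
    (chi1_char : multiplicative_char chi1)
    (chi2_char : multiplicative_char chi2)
    (chi_compat : chi1 (0, -1) * chi2 (1, 0) = 1) :
  (forall (H : hopfAlgebra k) (gam : 'Z_n * 'Z_n -> H) (x y : H),
     is_taft_tensor q gam x y ->
     forall K : {vspace H},
       left_coideal_subalgebra K ->
       homogeneous (taft_degree gam x y) (taft_top n) K ->
       exists (W1 W2 W3 : {vspace k^o * k^o}) (F : {group 'Z_n * 'Z_n}),
         coideal_datum (dot1 q) (dot2 q) W1 W2 W3 F /\
         K = datum_algebra gam x y W1 W2 W3 F)
  /\
  (forall (H : hopfAlgebra k) (gam : 'Z_n * 'Z_n -> H) (x y : H),
     is_taft_twist q chi1 chi2 gam x y ->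
     forall K : {vspace H},
       left_coideal_subalgebra K ->
       homogeneous (taft_degree gam x y) (taft_top n) K ->
       exists (W1 W2 W3 : {vspace k^o * k^o}) (F : {group 'Z_n * 'Z_n}),
         coideal_datum (rhd1 q chi1) (rhd2 q chi2) W1 W2 W3 F /\
         K = datum_algebra gam x y W1 W2 W3 F).
Proof.
have dot1P := dot1_char n_ge2 prim_q; have dot2P := dot2_char n_ge2 prim_q.
have charM (phi psi : 'Z_n * 'Z_n -> k) : multiplicative_char phi ->
    multiplicative_char psi -> multiplicative_char (fun f => phi f * psi f).
  move=> [phi0 phiD] [psi0 psiD]; split=> [|f f'].
    by rewrite phi0 psi0 mulr1.
  by rewrite phiD psiD mulrACA.
(* The commutation constant is 1, respectively [chi2 (1, 0)], a character value and so nonzero; the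
   twisted weights are products of characters. *)
split=> H gam x y hopfH K KP homK.
  exact: (homogeneous_coideal_datum n_ge2 chark prim_q (oner_neq0 k)).
exact: (homogeneous_coideal_datum n_ge2 chark prim_q
  (multiplicative_char_neq0 (1, 0) chi2_char) (charM _ _ chi1_char dot1P)
  (charM _ _ chi2_char dot2P)).
Qed.
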